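(* Let $\mathbf{L}$ be an $\ell$-group. Then: (1) For any perfect pseudo MV-algebra $\mathbf{A}$ there exists a homomorphism $\eta_{\mathbf{A}}\colon\mathbf{A}\to\mathcal{K}_{[\mathbf{A},\mathbf{L}]}(\mathbf{L})$ defined, for $x\in A$ and $\alpha\in[A,L]$, by $$(\eta_{\mathbf{A}}(x))(\alpha)=\begin{cases}\alpha(x)&\text{if }x\in F_{\mathbf{A}},\\ \alpha(x^{\sim})^{-1}&\text{if }x\in J_{\mathbf{A}},\end{cases}$$ and $\eta=(\eta_{\mathbf{A}})_{\mathbf{A}}$, indexed by perfect pseudo MV-algebras, is a natural transformation from the identity endofunctor to the endofunctor $\mathcal{K}_{[-,\mathbf{L}]}(\mathbf{L})$. (2) For any B-cycle $\mathbf{B}=(B;\lambda)$ there exists a homomorphism $\varepsilon_{\mathbf{B}}\colon\mathbf{B}\to[\mathcal{K}_{\mathbf{B}}(\mathbf{L}),\mathbf{L}]$ such that $(\varepsilon_{\mathbf{B}}(i))(x)=x(i)$ for any $i\in B$ and $x\in(L^-)^B$ (that is, $\varepsilon_{\mathbf{B}}(i)$ is the projection $\pi_i\colon(L^-)^B\to L^-$), and $\varepsilon=(\varepsilon_{\mathbf{B}})_{\mathbf{B}}$, indexed by B-cycles, is a natural transformation from the identity endofunctor to the endofunctor $[\mathcal{K}_{-}(\mathbf{L}),\mathbf{L}]$. (3) The pair $(\eta,\varepsilon)$ forms an adjunction between the contravariant functors $[-,\mathbf{L}]$ and $\mathcal{K}_{-}(\mathbf{L})$.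
   Context: A residuated lattice is an algebra $(A;\wedge,\vee,\cdot,\backslash,/,1)$ that is a lattice and a monoid with $y\le x\backslash z\iff xy\le z\iff x\le z/y$. An FL$_w$-algebra is a residuated lattice with an additional constant $0$ such that $1$ is the greatest and $0$ the least element; $x^-:=0/x$, $x^{\sim}:=x\backslash 0$. A pseudo MV-algebra is an FL$_w$-algebra satisfying $x/(y\backslash x)=x\vee y=(x/y)\backslash x$. An FL$_w$-algebra $\mathbf{A}$ is perfect if there is a homomorphism $h_{\mathbf{A}}\colon\mathbf{A}\to\mathbf{2}$ to the two-element Boolean algebra such that $x\le y$ whenever $h_{\mathbf{A}}(x)=0$, $h_{\mathbf{A}}(y)=1$ (such $h_{\mathbf A}$ is unique); $F_{\mathbf{A}}=h_{\mathbf{A}}^{-1}(1)$, $J_{\mathbf{A}}=h_{\mathbf{A}}^{-1}(0)$, and $\mathbf{F}_{\mathbf{A}}$ is the corresponding subalgebra of the $0$-free (residuated lattice) reduct of $\mathbf{A}$. Perfect pseudo MV-algebras form a category with homomorphisms as arrows. For $\mathbf{A}$ a perfect pseudo MV-algebra, $x\mapsto x^{\sim\sim}$ is an automorphism of $\mathbf{F}_{\mathbf{A}}$. For an $\ell$-group $\mathbf{L}$ with unit $e$, $L^-=\{x\le e\}$, $L^+=\{x\ge e\}$, and $\mathbf{L}^-$ is the residuated lattice on $L^-$ with $\wedge,\vee,\cdot,e$ inherited and $x/y:=xy^{-1}\wedge e$, $y\backslash x:=y^{-1}x\wedge e$. For an automorphism $\lambda$ of $\mathbf{L}$, $\mathcal{K}(\mathbf{L},\lambda)=(L^-\uplus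 L^+;\wedge,\vee,\odot,\backslash,/,0,1)$ is the perfect pseudo MV-algebra in which $0:=e\in L^+$, $1:=e\in L^-$, $L^+$ lies entirely below $L^-$, lattice operations within $L^-$ and within $L^+$ are those of $\mathbf{L}$, and $x\odot y$ is: $xy\in L^-$ if $x,y\in L^-$; $\lambda(x)y\vee e\in L^+$ if $x\in L^-,y\in L^+$; $xy\vee e\in L^+$ if $x\in L^+,y\in L^-$; $e\in L^+$ if $x,y\in L^+$ (the residuals are determined by $\odot$ and the order). Here $F_{\mathcal{K}(\mathbf{L},\lambda)}=L^-$, $J_{\mathcal{K}(\mathbf{L},\lambda)}=L^+$. A B-cycle is a pair $\mathbf{B}=(B;\beta)$ with $\beta$ a bijection on $B$; homomorphisms of B-cycles are maps commuting with the bijections; $\mathsf{BC}$ is the resulting category. The kite over $\mathbf{B}$ and $\mathbf{L}$ is $\mathcal{K}_{\mathbf{B}}(\mathbf{L}):=\mathcal{K}(\mathbf{L}^B,\lambda)$ with $\lambda(x)(i)=x(\beta(i))$. For a B-cycle homomorphism $f\colon\mathbf{B}\to\mathbf{C}$, $\mathcal{K}_f(\mathbf{L})\colon\mathcal{K}_{\mathbf{C}}(\mathbf{L})\to\mathcal{K}_{\mathbf{B}}(\mathbf{L})$ is $x\mapsto x\circ f$; thus $\mathcal{K}_{-}(\mathbf{L})$ is a contravariant functor from $\mathsf{BC}$ to perfect pseudo MV-algebras. For a perfect pseudo MV-algebra $\mathbf{A}$ and an $\ell$-group $\mathbf{L}$, $[\mathbf{A},\mathbf{L}]=([A,L];\lambda)$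 is the B-cycle where $[A,L]$ is the set of all residuated lattice homomorphisms $\alpha\colon\mathbf{F}_{\mathbf{A}}\to\mathbf{L}^-$ and $(\lambda(\alpha))(x):=\alpha(x^{\sim\sim})$. For a homomorphism $f\colon\mathbf{A}_1\to\mathbf{A}_2$, $[f,\mathbf{L}]\colon[\mathbf{A}_2,\mathbf{L}]\to[\mathbf{A}_1,\mathbf{L}]$ is $\alpha\mapsto\alpha\circ f$ (restricted to $F_{\mathbf{A}_1}$); thus $[-,\mathbf{L}]$ is a contravariant functor from perfect pseudo MV-algebras to $\mathsf{BC}$. That $(\eta,\varepsilon)$ is an adjunction between these contravariant functors means that the triangle identities $\mathcal{K}_{\varepsilon_{\mathbf{B}}}(\mathbf{L})\circ\eta_{\mathcal{K}_{\mathbf{B}}(\mathbf{L})}=\mathrm{id}$ and $[\eta_{\mathbf{A}},\mathbf{L}]\circ\varepsilon_{[\mathbf{A},\mathbf{L}]}=\mathrm{id}$ hold for all $\mathbf{B}$ and $\mathbf{A}$. *)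

(* Defs.v *)
From mathcomp Require Import ssreflect ssrfun ssrbool.
From Stdlib Require Import FunctionalExtensionality ProofIrrelevance ClassicalEpsilon.
Set Implicit Arguments.
Unset Strict Implicit.
Unset Printing Implicit Defensive.

(* Algebras are bundled over arbitrary types, without decidability
   requirements, so that function spaces and types of homomorphisms are
   carriers again. *)

Lemma sig_ext (T : Type) (P : T -> Prop) (x y : {z : T | P z}) :
  proj1_sig x = proj1_sig y -> x = y.
Proof.
case: x y => [x px] [y py] /= e; move: px; rewrite e => px.
by rewrite (proof_irrelevance _ px py).
Qed.

Record lattice := Lattice {
  lat_sort :> Type;
  meet : lat_sort -> lat_sort -> lat_sort;
  join : lat_sort -> lat_sort -> lat_sort;
  meetC : forall x y, meet x y = meet y x;
  joinC : forall x y, join x y = join y x;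
  meetA : forall x y z, meet x (meet y z) = meet (meet x y) z;
  joinA : forall x y z, join x (join y z) = join (join x y) z;
  meet_join : forall x y, meet x (join x y) = x;
  join_meet : forall x y, join x (meet x y) = x }.

Declare Scope alg_scope.
Delimit Scope alg_scope with alg.
Local Open Scope alg_scope.

Definition le (T : lattice) (x y : T) : Prop := meet x y = x.
Notation "x <= y" := (le x y) : alg_scope.

Lemma meetxx (T : lattice) (x : T) : meet x x = x.
Proof. by rewrite -{2}(join_meet x x) meet_join. Qed.

Lemma joinxx (T : lattice) (x : T) : join x x = x.
Proof. by rewrite -{2}(meet_join x x) join_meet. Qed.

Lemma lexx (T : lattice) (x : T) : x <= x.
Proof. exact: meetxx. Qed.

Lemma le_eq (T : lattice) (x y : T) : x = y -> x <= y.
Proof. by move=> ->; exact: lexx. Qed.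

Lemma le_anti (T : lattice) (x y : T) : x <= y -> y <= x -> x = y.
Proof. by rewrite /le => xy yx; rewrite -xy meetC. Qed.

Lemma le_trans (T : lattice) (y x z : T) : x <= y -> y <= z -> x <= z.
Proof. by rewrite /le => xy yz; rewrite -{1}xy -meetA yz. Qed.

Lemma leIl (T : lattice) (x y : T) : meet x y <= x.
Proof. by rewrite /le meetC meetA meetxx. Qed.

Lemma leIr (T : lattice) (x y : T) : meet x y <= y.
Proof. by rewrite /le -meetA meetxx. Qed.

Lemma lexI (T : lattice) (x y z : T) : z <= x -> z <= y -> z <= meet x y.
Proof. by rewrite /le => zx zy; rewrite meetA zx. Qed.

Lemma leUl (T : lattice) (x y : T) : x <= join x y.
Proof. exact: meet_join. Qed.

Lemma leUr (T : lattice) (x y : T) : y <= join x y.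
Proof. by rewrite joinC; exact: leUl. Qed.

Lemma le_join (T : lattice) (x y : T) : x <= y <-> join x y = y.
Proof.
rewrite /le; split=> [<-|<-]; last exact: meet_join.
by rewrite joinC meetC join_meet.
Qed.

Lemma leUx (T : lattice) (x y z : T) : x <= z -> y <= z -> join x y <= z.
Proof. by move=> /le_join xz /le_join yz; apply/le_join; rewrite -joinA yz. Qed.

Lemma join_l (T : lattice) (x y : T) : y <= x -> join x y = x.
Proof. by move=> /le_join; rewrite joinC. Qed.

Lemma meet_r (T : lattice) (x y : T) : y <= x -> meet x y = y.
Proof. by rewrite meetC. Qed.

Lemma le_ext (T : lattice) (x y : T) :
  (forall z, z <= x <-> z <= y) -> x = y.
Proof. by move=> H; apply: le_anti; [apply/H|apply/H]; exact: lexx. Qed.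

Lemma meetP (T : lattice) (x y z : T) : z <= meet x y <-> z <= x /\ z <= y.
Proof.
split=> [H|[]]; last exact: lexI.
by split; apply: (le_trans H); [exact: leIl|exact: leIr].
Qed.

Lemma joinP (T : lattice) (x y z : T) : join x y <= z <-> x <= z /\ y <= z.
Proof.
split=> [H|[]]; last exact: leUx.
by split; apply: (le_trans _ H); [exact: leUl|exact: leUr].
Qed.

Lemma ge_ext (T : lattice) (x y : T) : (forall z, x <= z <-> y <= z) -> x = y.
Proof. by move=> H; apply: le_anti; [apply/H|apply/H]; exact: lexx. Qed.

Definition sub_lattice (T : lattice) (P : T -> Prop)
    (PI : forall x y, P x -> P y -> P (meet x y))
    (PU : forall x y, P x -> P y -> P (join x y)) : lattice.
Proof.
exists {x : T | P x}
  (fun x y => exist _ (meet (sval x) (sval y)) (PI _ _ (svalP x) (svalP y)))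
  (fun x y => exist _ (join (sval x) (sval y)) (PU _ _ (svalP x) (svalP y)))
  => *; apply: sig_ext => /=.
- exact: meetC.
- exact: joinC.
- exact: meetA.
- exact: joinA.
- exact: meet_join.
- exact: join_meet.
Defined.

Lemma sub_le (T : lattice) (P : T -> Prop) PI PU
    (x y : @sub_lattice T P PI PU) :
  x <= y <-> sval x <= sval y.
Proof. by split=> [/(congr1 (fun z => sval z))|e] //; apply: sig_ext. Qed.

(* [ldiv x z] is x\z and [rdiv z y] is z/y. *)
Record resLattice := ResLattice {
  rl_lattice :> lattice;
  rmul : rl_lattice -> rl_lattice -> rl_lattice;
  ldiv : rl_lattice -> rl_lattice -> rl_lattice;
  rdiv : rl_lattice -> rl_lattice -> rl_lattice;
  rone : rl_lattice;
  rmulA : forall x y z, rmul x (rmul y z) = rmul (rmul x y) z;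
  rmul1l : forall x, rmul rone x = x;
  rmul1r : forall x, rmul x rone = x;
  ldivP : forall x y z, y <= ldiv x z <-> rmul x y <= z;
  rdivP : forall x y z, x <= rdiv z y <-> rmul x y <= z }.

Arguments rone {r}.

Record FLw := MkFLw {
  fl_resLattice :> resLattice;
  fl0 : fl_resLattice;
  fl_le1 : forall x : fl_resLattice, x <= rone;
  fl_ge0 : forall x : fl_resLattice, fl0 <= x }.

Arguments fl0 {f}.

Definition lneg (A : FLw) (x : A) : A := rdiv fl0 x.
Definition ltil (A : FLw) (x : A) : A := ldiv x fl0.

Definition pseudoMV (A : FLw) : Prop := forall x y : A,
  rdiv x (ldiv y x) = join x y /\ ldiv (rdiv x y) x = join x y.

Record rlHom (A B : resLattice) := RlHom {
  rl_fun :> A -> B;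
  rl_meet : forall x y, rl_fun (meet x y) = meet (rl_fun x) (rl_fun y);
  rl_join : forall x y, rl_fun (join x y) = join (rl_fun x) (rl_fun y);
  rl_mul : forall x y, rl_fun (rmul x y) = rmul (rl_fun x) (rl_fun y);
  rl_ldiv : forall x y, rl_fun (ldiv x y) = ldiv (rl_fun x) (rl_fun y);
  rl_rdiv : forall x y, rl_fun (rdiv x y) = rdiv (rl_fun x) (rl_fun y);
  rl_one : rl_fun rone = rone }.

Record flHom (A B : FLw) := FlHom {
  fl_hom :> rlHom A B;
  fl_zero : fl_hom fl0 = fl0 }.

Lemma rlHom_ext (A B : resLattice) (f g : rlHom A B) :
  (forall x, f x = g x) -> f = g.
Proof.
case: f g => [f f1 f2 f3 f4 f5 f6] [g g1 g2 g3 g4 g5 g6] /= e.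
have {}e : f = g by apply: functional_extensionality.
move: f1 f2 f3 f4 f5 f6; rewrite e => *.
by f_equal; apply: proof_irrelevance.
Qed.

Lemma flHom_ext (A B : FLw) (f g : flHom A B) : (forall x, f x = g x) -> f = g.
Proof.
case: f g => [f f0] [g g0] /= /rlHom_ext e.
by move: f0; rewrite e => f0; f_equal; apply: proof_irrelevance.
Qed.

Definition rl_id (A : resLattice) : rlHom A A.
Proof. by exists id. Defined.

Definition rl_comp (A B C : resLattice) (g : rlHom B C) (f : rlHom A B) :
  rlHom A C.
Proof.
exists (fun x => g (f x)) => *;
  by rewrite ?(rl_meet, rl_join, rl_mul, rl_ldiv, rl_rdiv, rl_one).
Defined.

Definition fl_id (A : FLw) : flHom A A.
Proof. by exists (rl_id A). Defined.

Definition fl_comp (A B C : FLw) (g : flHom B C) (f : flHom A B) : flHom A C.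
Proof. by exists (rl_comp g f) => /=; rewrite !fl_zero. Defined.

Lemma rl_le (A B : resLattice) (f : rlHom A B) (x y : A) : x <= y -> f x <= f y.
Proof. by rewrite /le => e; rewrite -rl_meet e. Qed.

Lemma hom_lneg (A B : FLw) (f : flHom A B) x : f (lneg x) = lneg (f x).
Proof. by rewrite /lneg rl_rdiv fl_zero. Qed.

Lemma hom_ltil (A B : FLw) (f : flHom A B) x : f (ltil x) = ltil (f x).
Proof. by rewrite /ltil rl_ldiv fl_zero. Qed.

Lemma rmul_le2l (A : resLattice) (x y z : A) :
  x <= y -> rmul z x <= rmul z y.
Proof. move=> xy; apply/ldivP; apply: (le_trans xy); apply/ldivP; exact: lexx. Qed.

Lemma rmul_le2r (A : resLattice) (x y z : A) :
  x <= y -> rmul x z <= rmul y z.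
Proof. move=> xy; apply/rdivP; apply: (le_trans xy); apply/rdivP; exact: lexx. Qed.

Definition two_lattice : lattice.
Proof. by exists bool andb orb; do ?case. Defined.

Definition two_resLattice : resLattice.
Proof. by exists two_lattice andb implb (fun y x => implb x y) true; do ?case. Defined.

Definition two : FLw.
Proof. by exists two_resLattice false; case. Defined.

Definition separating (A : FLw) (h : flHom A two) : Prop :=
  forall x y : A, h x = false -> h y = true -> x <= y.

Definition perfect (A : FLw) : Prop := exists h : flHom A two, separating h.

Record perfectPMV := PerfectPMV {
  ppmv_FLw :> FLw;
  ppmv_pseudoMV : pseudoMV ppmv_FLw;
  ppmv_perfect : perfect ppmv_FLw }.

(* [h_A] is extracted by choice from the existence statement; it is the only
   homomorphism to [two] (see [hA_unique]). *)
Definition hA (A : perfectPMV) : flHom A two :=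
  proj1_sig (constructive_indefinite_description _ (ppmv_perfect A)).

Lemma hA_separating (A : perfectPMV) : separating (hA A).
Proof. exact: (proj2_sig (constructive_indefinite_description _ (ppmv_perfect A))). Qed.

Lemma flHom_two_unique (A : FLw) (h g : flHom A two) :
  separating h -> forall x, g x = h x.
Proof.
move=> sep.
have J x : h x = false -> g x = false.
  move=> hx; have : x <= ltil x by apply: sep; rewrite // hom_ltil /ltil /= hx.
  move=> /ldivP /(rl_le g); rewrite rl_mul fl_zero /le /=.
  by case: (g x).
move=> x; case hx: (h x); last exact: J.
have : g (ltil x) = false by apply: J; rewrite hom_ltil /ltil /= hx.
by rewrite hom_ltil /ltil /=; case: (g x).
Qed.

Lemma hA_unique (A : perfectPMV) (g : flHom A two) x : g x = hA A x.
Proof. exact/flHom_two_unique/hA_separating. Qed.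

Lemma hA_hom (A1 A2 : perfectPMV) (f : flHom A1 A2) x : hA A2 (f x) = hA A1 x.
Proof. by rewrite -(hA_unique (fl_comp (hA A2) f)). Qed.

Lemma hA_ltil (A : perfectPMV) (x : A) : hA A (ltil x) = ~~ hA A x.
Proof. by rewrite hom_ltil /ltil /=; case: (hA A x). Qed.

Lemma hA_lneg (A : perfectPMV) (x : A) : hA A (lneg x) = ~~ hA A x.
Proof. by rewrite hom_lneg /lneg /=; case: (hA A x). Qed.

Definition F_set (A : perfectPMV) : Type := {x : A | hA A x = true}.
Definition J_set (A : perfectPMV) : Type := {x : A | hA A x = false}.

Lemma F_meet (A : perfectPMV) (x y : A) :
  hA A x = true -> hA A y = true -> hA A (meet x y) = true.
Proof. by rewrite rl_meet => -> ->. Qed.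

Lemma F_join (A : perfectPMV) (x y : A) :
  hA A x = true -> hA A y = true -> hA A (join x y) = true.
Proof. by rewrite rl_join => -> ->. Qed.

Lemma F_mul (A : perfectPMV) (x y : A) :
  hA A x = true -> hA A y = true -> hA A (rmul x y) = true.
Proof. by rewrite rl_mul => -> ->. Qed.

Lemma F_ldiv (A : perfectPMV) (x y : A) :
  hA A x = true -> hA A y = true -> hA A (ldiv x y) = true.
Proof. by rewrite rl_ldiv => -> ->. Qed.

Lemma F_rdiv (A : perfectPMV) (x y : A) :
  hA A x = true -> hA A y = true -> hA A (rdiv x y) = true.
Proof. by rewrite rl_rdiv => -> ->. Qed.

Definition F_lattice (A : perfectPMV) : lattice :=
  sub_lattice (@F_meet A) (@F_join A).

Definition F_alg (A : perfectPMV) : resLattice.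
Proof.
exists (F_lattice A)
  (fun x y => exist _ (rmul (sval x) (sval y)) (F_mul (svalP x) (svalP y)))
  (fun x y => exist _ (ldiv (sval x) (sval y)) (F_ldiv (svalP x) (svalP y)))
  (fun x y => exist _ (rdiv (sval x) (sval y)) (F_rdiv (svalP x) (svalP y)))
  (exist _ rone (rl_one (hA A))).
- by move=> *; apply: sig_ext; exact: rmulA.
- by move=> *; apply: sig_ext; exact: rmul1l.
- by move=> *; apply: sig_ext; exact: rmul1r.
- by move=> x y z; rewrite !sub_le; exact: ldivP.
- by move=> x y z; rewrite !sub_le; exact: rdivP.
Defined.

Lemma F_map_subproof (A1 A2 : perfectPMV) (f : flHom A1 A2) (x : F_alg A1) :
  hA A2 (f (sval x)) = true.
Proof. by rewrite hA_hom; exact: svalP x. Qed.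

Definition F_map (A1 A2 : perfectPMV) (f : flHom A1 A2) :
  rlHom (F_alg A1) (F_alg A2).
Proof.
exists (fun x => exist _ (f (sval x)) (F_map_subproof f x)) => *;
  apply: sig_ext => /=;
  by rewrite ?(rl_meet, rl_join, rl_mul, rl_ldiv, rl_rdiv, rl_one).
Defined.

Lemma J_ltil_subproof (A : perfectPMV) (x : J_set A) : hA A (ltil (sval x)) = true.
Proof. by rewrite hA_ltil (svalP x). Qed.

Definition J_ltil (A : perfectPMV) (x : J_set A) : F_alg A :=
  exist _ (ltil (sval x)) (J_ltil_subproof x).

Lemma ltilK (A : FLw) : pseudoMV A -> forall x : A, lneg (ltil x) = x.
Proof. move=> P x; rewrite /lneg /ltil (P fl0 x).1; apply/le_join; exact: fl_ge0. Qed.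

Lemma lnegK (A : FLw) : pseudoMV A -> forall x : A, ltil (lneg x) = x.
Proof. move=> P x; rewrite /lneg /ltil (P fl0 x).2; apply/le_join; exact: fl_ge0. Qed.

Lemma le_ltil (A : FLw) (P : pseudoMV A) (x y : A) : x <= y <-> ltil y <= ltil x.
Proof.
rewrite -{1}[y]ltilK //; split.
- by move=> /rdivP H; apply/ldivP.
- by move=> /ldivP H; apply/rdivP.
Qed.

Lemma le_lneg (A : FLw) (P : pseudoMV A) (x y : A) : x <= y <-> lneg y <= lneg x.
Proof. by rewrite (le_ltil P (lneg y)) !lnegK. Qed.

Lemma mul0_cyc (A : FLw) (P : pseudoMV A) (x y : A) :
  rmul x y <= fl0 <-> rmul y (ltil (ltil x)) <= fl0.
Proof.
have E : rmul x y <= fl0 <-> y <= ltil x by split=> /ldivP.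
by rewrite E -{1}[ltil x]ltilK //; split=> /rdivP.
Qed.

Lemma tt_mul (A : FLw) (P : pseudoMV A) (x y : A) :
  ltil (ltil (rmul x y)) = rmul (ltil (ltil x)) (ltil (ltil y)).
Proof.
rewrite -[LHS]lnegK // -[RHS]lnegK //; congr ltil; apply: le_ext => z.
have E u : z <= lneg u <-> rmul z u <= fl0 by split=> /rdivP.
rewrite !E -mul0_cyc // rmulA -mul0_cyc // rmulA -mul0_cyc // rmulA //.
Qed.

Lemma tt_le (A : FLw) (P : pseudoMV A) (x y : A) :
  x <= y <-> ltil (ltil x) <= ltil (ltil y).
Proof. by rewrite le_ltil // le_ltil. Qed.

Lemma ttK (A : FLw) (P : pseudoMV A) (x : A) : lneg (lneg (ltil (ltil x))) = x.
Proof. by rewrite !ltilK. Qed.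

Lemma nnK (A : FLw) (P : pseudoMV A) (x : A) : ltil (ltil (lneg (lneg x))) = x.
Proof. by rewrite !lnegK. Qed.

Lemma bij_rlHom (A B : resLattice) (f : A -> B) (g : B -> A) :
  (forall x, g (f x) = x) -> (forall x, f (g x) = x) ->
  (forall x y, x <= y <-> f x <= f y) ->
  (forall x y, f (rmul x y) = rmul (f x) (f y)) ->
  [/\ forall x y, f (meet x y) = meet (f x) (f y),
      forall x y, f (join x y) = join (f x) (f y),
      forall x y, f (ldiv x y) = ldiv (f x) (f y),
      forall x y, f (rdiv x y) = rdiv (f x) (f y) & f rone = rone].
Proof.
move=> fK gK fle fM; split.
- by move=> x y; apply: le_ext => z; rewrite -[z]gK -fle !meetP -!fle.
- by move=> x y; apply: ge_ext => z; rewrite -[z]gK -fle !joinP -!fle.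
- by move=> x y; apply: le_ext => z; rewrite -[z]gK -fle !ldivP -fM -fle.
- by move=> x y; apply: le_ext => z; rewrite -[z]gK -fle !rdivP -fM -fle.
- by rewrite -[LHS]rmul1r -{1}(gK rone) -fM rmul1l gK.
Qed.

Lemma F_tt_subproof (A : perfectPMV) (x : F_alg A) :
  hA A (ltil (ltil (sval x))) = true.
Proof. by rewrite !hA_ltil (svalP x). Qed.

Lemma F_nn_subproof (A : perfectPMV) (x : F_alg A) :
  hA A (lneg (lneg (sval x))) = true.
Proof. by rewrite !hA_lneg (svalP x). Qed.

Definition F_tt_fun (A : perfectPMV) (x : F_alg A) : F_alg A :=
  exist _ (ltil (ltil (sval x))) (F_tt_subproof x).

Definition F_nn_fun (A : perfectPMV) (x : F_alg A) : F_alg A :=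
  exist _ (lneg (lneg (sval x))) (F_nn_subproof x).

Lemma F_ttK (A : perfectPMV) (x : F_alg A) : F_nn_fun (F_tt_fun x) = x.
Proof. by apply: sig_ext; exact/ttK/ppmv_pseudoMV. Qed.

Lemma F_nnK (A : perfectPMV) (x : F_alg A) : F_tt_fun (F_nn_fun x) = x.
Proof. by apply: sig_ext; exact/nnK/ppmv_pseudoMV. Qed.

Lemma F_tt_le (A : perfectPMV) (x y : F_alg A) :
  x <= y <-> F_tt_fun x <= F_tt_fun y.
Proof. by rewrite !sub_le tt_le //; exact: ppmv_pseudoMV. Qed.

Lemma F_tt_mul (A : perfectPMV) (x y : F_alg A) :
  F_tt_fun (rmul x y) = rmul (F_tt_fun x) (F_tt_fun y).
Proof. by apply: sig_ext; exact/tt_mul/ppmv_pseudoMV. Qed.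

(* x |-> x^~~ on F_A, with inverse [F_nn] : x |-> x^-- *)
Definition F_tt (A : perfectPMV) : rlHom (F_alg A) (F_alg A).
Proof.
exists (@F_tt_fun A).
all: try exact: F_tt_mul.
all: by have [] := bij_rlHom (@F_ttK A) (@F_nnK A) (@F_tt_le A) (@F_tt_mul A).
Defined.

Definition F_nn (A : perfectPMV) : rlHom (F_alg A) (F_alg A).
Proof.
exists (@F_nn_fun A).
all: have le' (x y : F_alg A) : x <= y <-> F_nn_fun x <= F_nn_fun y
  by rewrite (F_tt_le (F_nn_fun x)) !F_nnK.
all: have mul' (x y : F_alg A) : F_nn_fun (rmul x y) = rmul (F_nn_fun x) (F_nn_fun y)
  by rewrite -[RHS]F_ttK F_tt_mul !F_nnK.
all: have [] := bij_rlHom (@F_nnK A) (@F_ttK A) le' mul'; by [].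
Defined.

Record lGroup := LGroup {
  lg_lattice :> lattice;
  gmul : lg_lattice -> lg_lattice -> lg_lattice;
  ginv : lg_lattice -> lg_lattice;
  gone : lg_lattice;
  gmulA : forall x y z, gmul x (gmul y z) = gmul (gmul x y) z;
  gmul1l : forall x, gmul gone x = x;
  gmul1r : forall x, gmul x gone = x;
  gmulVl : forall x, gmul (ginv x) x = gone;
  gmulVr : forall x, gmul x (ginv x) = gone;
  gmul_le : forall a b x y,
    x <= y -> gmul (gmul a x) b <= gmul (gmul a y) b }.

Arguments gone {l}.

Notation "x * y" := (gmul x y) : alg_scope.
Notation "x ^-1" := (ginv x) : alg_scope.

Lemma gmulKl (G : lGroup) (x y : G) : x^-1 * (x * y) = y.
Proof. by rewrite gmulA gmulVl gmul1l. Qed.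

Lemma gmulVKl (G : lGroup) (x y : G) : x * (x^-1 * y) = y.
Proof. by rewrite gmulA gmulVr gmul1l. Qed.

Lemma gmulKr (G : lGroup) (x y : G) : (y * x) * x^-1 = y.
Proof. by rewrite -gmulA gmulVr gmul1r. Qed.

Lemma gmulVKr (G : lGroup) (x y : G) : (y * x^-1) * x = y.
Proof. by rewrite -gmulA gmulVl gmul1r. Qed.

Lemma gle_l (G : lGroup) (a x y : G) : x <= y -> a * x <= a * y.
Proof. by move=> /(gmul_le a gone); rewrite !gmul1r. Qed.

Lemma gle_r (G : lGroup) (a x y : G) : x <= y -> x * a <= y * a.
Proof. by move=> /(gmul_le gone a); rewrite !gmul1l. Qed.

Lemma gdivl (G : lGroup) (x y z : G) : y <= x^-1 * z <-> x * y <= z.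
Proof.
split=> [/(gle_l x)|/(gle_l (x^-1))]; first by rewrite gmulVKl.
by rewrite gmulKl.
Qed.

Lemma gdivr (G : lGroup) (x y z : G) : x <= z * y^-1 <-> x * y <= z.
Proof.
split=> [/(gle_r y)|/(gle_r (y^-1))]; first by rewrite gmulVKr.
by rewrite gmulKr.
Qed.

Lemma ginv_uniq (G : lGroup) (x y : G) : x * y = gone -> y = x^-1.
Proof. by move=> e; rewrite -[y](gmulKl x) e gmul1r. Qed.

Lemma ginvK (G : lGroup) (x : G) : x^-1^-1 = x.
Proof. by symmetry; apply: ginv_uniq; rewrite gmulVl. Qed.

Lemma ginvM (G : lGroup) (x y : G) : (x * y)^-1 = y^-1 * x^-1.
Proof. by symmetry; apply: ginv_uniq; rewrite gmulA gmulKr gmulVr. Qed.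

Lemma ginv1 (G : lGroup) : (gone : G)^-1 = gone.
Proof. by symmetry; apply: ginv_uniq; rewrite gmul1l. Qed.

Lemma ginv_le (G : lGroup) (x y : G) : x <= y <-> y^-1 <= x^-1.
Proof.
have H (u v : G) : u <= v -> v^-1 <= u^-1.
  move=> uv; rewrite -[u^-1]gmul1r; apply/gdivl.
  by rewrite -[gone](gmulVr v); exact: gle_r.
by split; [exact: H | move=> /H; rewrite !ginvK].
Qed.

Lemma ginvI (G : lGroup) (x y : G) : (meet x y)^-1 = join x^-1 y^-1.
Proof.
apply: ge_ext => z; rewrite joinP -[z]ginvK -!ginv_le.
by rewrite meetP.
Qed.

Lemma ginvU (G : lGroup) (x y : G) : (join x y)^-1 = meet x^-1 y^-1.
Proof. by rewrite -[RHS]ginvK ginvI !ginvK. Qed.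

Lemma gmulIl (G : lGroup) (a x y : G) : a * meet x y = meet (a * x) (a * y).
Proof.
apply: le_ext => z; rewrite meetP -[a]ginvK !gdivl.
by rewrite meetP.
Qed.

Lemma gmulUl (G : lGroup) (a x y : G) : a * join x y = join (a * x) (a * y).
Proof. by apply: ge_ext => z; rewrite joinP -!gdivl joinP. Qed.

Lemma gmulUr (G : lGroup) (a x y : G) : join x y * a = join (x * a) (y * a).
Proof. by apply: ge_ext => z; rewrite joinP -!gdivr joinP. Qed.

Lemma ginv_le1 (G : lGroup) (x : G) : x <= gone -> gone <= x^-1.
Proof. by move=> /ginv_le; rewrite ginv1. Qed.

Lemma ginv_ge1 (G : lGroup) (x : G) : gone <= x -> x^-1 <= gone.
Proof. by move=> /ginv_le; rewrite ginv1. Qed.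

Lemma gmul_le1 (G : lGroup) (x y : G) : x <= gone -> y <= gone -> x * y <= gone.
Proof. by move=> /(gle_r y); rewrite gmul1l; exact: le_trans. Qed.

Lemma gmul_ge1 (G : lGroup) (x y : G) : gone <= x -> gone <= y -> gone <= x * y.
Proof. by move=> /(gle_r y); rewrite gmul1l => h /le_trans; exact. Qed.

(* The inverse is carried as data; preservation of the operations by the inverse,
   of the unit and of inverses follows. *)
Record lgAut (G : lGroup) := LgAut {
  aut_fun :> G -> G;
  aut_inv : G -> G;
  aut_funK : cancel aut_fun aut_inv;
  aut_invK : cancel aut_inv aut_fun;
  aut_meet : forall x y, aut_fun (meet x y) = meet (aut_fun x) (aut_fun y);
  aut_join : forall x y, aut_fun (join x y) = join (aut_fun x) (aut_fun y);
  aut_mul : forall x y, aut_fun (x * y) = aut_fun x * aut_fun y }.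

Lemma aut_one (G : lGroup) (l : lgAut G) : l gone = gone.
Proof. by rewrite -[LHS](gmulKl (l gone)) -aut_mul gmul1l gmulVl. Qed.

Lemma aut_le (G : lGroup) (l : lgAut G) (x y : G) : x <= y <-> l x <= l y.
Proof.
rewrite /le -aut_meet; split=> [->//|].
by move/(congr1 (aut_inv l)); rewrite !aut_funK.
Qed.

Lemma aut_le1 (G : lGroup) (l : lgAut G) (x : G) : x <= gone -> l x <= gone.
Proof. by move/(aut_le l); rewrite aut_one. Qed.

Lemma neg_meet (G : lGroup) (x y : G) :
  x <= gone -> y <= gone -> meet x y <= gone.
Proof. by move=> x1 _; apply: le_trans x1; exact: leIl. Qed.

Lemma neg_join (G : lGroup) (x y : G) :
  x <= gone -> y <= gone -> join x y <= gone.
Proof. exact: leUx. Qed.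

Lemma pos_meet (G : lGroup) (x y : G) :
  gone <= x -> gone <= y -> gone <= meet x y.
Proof. exact: lexI. Qed.

Lemma pos_join (G : lGroup) (x y : G) :
  gone <= x -> gone <= y -> gone <= join x y.
Proof. by move=> x1 _; apply: (le_trans x1); exact: leUl. Qed.

Definition neg_lattice (G : lGroup) : lattice :=
  sub_lattice (@neg_meet G) (@neg_join G).

Definition pos_lattice (G : lGroup) : lattice :=
  sub_lattice (@pos_meet G) (@pos_join G).

Definition mkneg (G : lGroup) (x : G) (h : x <= gone) : neg_lattice G :=
  exist _ x h.

Definition mkpos (G : lGroup) (x : G) (h : gone <= x) : pos_lattice G :=
  exist _ x h.

Definition neg_one (G : lGroup) : neg_lattice G := mkneg (lexx gone).

Definition neg_mul (G : lGroup) (x y : neg_lattice G) : neg_lattice G :=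
  mkneg (gmul_le1 (svalP x) (svalP y)).

Definition neg_ldiv (G : lGroup) (y x : neg_lattice G) : neg_lattice G :=
  mkneg (leIr ((sval y)^-1 * sval x) gone).

Definition neg_rdiv (G : lGroup) (x y : neg_lattice G) : neg_lattice G :=
  mkneg (leIr (sval x * (sval y)^-1) gone).

Lemma neg_ldivP (G : lGroup) (x y z : neg_lattice G) :
  y <= neg_ldiv x z <-> neg_mul x y <= z.
Proof.
rewrite !sub_le /= meetP gdivl; split=> [[]//|H]; split=> //; exact: svalP y.
Qed.

Lemma neg_rdivP (G : lGroup) (x y z : neg_lattice G) :
  x <= neg_rdiv z y <-> neg_mul x y <= z.
Proof.
rewrite !sub_le /= meetP gdivr; split=> [[]//|H]; split=> //; exact: svalP x.
Qed.

Definition neg_cone (G : lGroup) : resLattice.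
Proof.
exists (neg_lattice G) (@neg_mul G) (@neg_ldiv G) (@neg_rdiv G) (@neg_one G).
- by move=> x y z; apply: sig_ext; exact: gmulA.
- by move=> x; apply: sig_ext; exact: gmul1l.
- by move=> x; apply: sig_ext; exact: gmul1r.
- exact: neg_ldivP.
- exact: neg_rdivP.
Defined.

Definition neg_inv (G : lGroup) (x : neg_cone G) : pos_lattice G :=
  mkpos (ginv_le1 (svalP x)).

(* [inl] tags L^- (the filter), [inr] tags L^+ (the ideal). *)
Definition K_sort (G : lGroup) : Type := (neg_lattice G + pos_lattice G)%type.

Definition K_meet (G : lGroup) (x y : K_sort G) : K_sort G :=
  match x, y with
  | inl x, inl y => inl (meet x y)
  | inl x, inr y => inr y
  | inr x, inl y => inr x
  | inr x, inr y => inr (meet x y)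
  end.

Definition K_join (G : lGroup) (x y : K_sort G) : K_sort G :=
  match x, y with
  | inl x, inl y => inl (join x y)
  | inl x, inr y => inl x
  | inr x, inl y => inl y
  | inr x, inr y => inr (join x y)
  end.

Definition K_lattice (G : lGroup) : lattice.
Proof.
exists (K_sort G) (@K_meet G) (@K_join G).
- move=> [x|x] [y|y]; first [by [] | exact: (congr1 inl (meetC _ _)) | exact: (congr1 inr (meetC _ _))].
- move=> [x|x] [y|y]; first [by [] | exact: (congr1 inl (joinC _ _)) | exact: (congr1 inr (joinC _ _))].
- move=> [x|x] [y|y] [z|z]; first [by [] | exact: (congr1 inl (meetA _ _ _)) | exact: (congr1 inr (meetA _ _ _))].
- move=> [x|x] [y|y] [z|z]; first [by [] | exact: (congr1 inl (joinA _ _ _)) | exact: (congr1 inr (joinA _ _ _))].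
- move=> [x|x] [y|y]; first [by [] | exact: (congr1 inl (meet_join _ _))
    | exact: (congr1 inr (meet_join _ _)) | exact: (congr1 inl (meetxx _))
    | exact: (congr1 inr (meetxx _))].
- move=> [x|x] [y|y]; first [by [] | exact: (congr1 inl (join_meet _ _))
    | exact: (congr1 inr (join_meet _ _)) | exact: (congr1 inl (joinxx _))
    | exact: (congr1 inr (joinxx _))].
Defined.

Definition K_mul (G : lGroup) (l : lgAut G) (x y : K_lattice G) : K_lattice G :=
  match x, y with
  | inl x, inl y => inl (neg_mul x y)
  | inl x, inr y => inr (mkpos (leUr (l (sval x) * sval y) gone))
  | inr x, inl y => inr (mkpos (leUr (sval x * sval y) gone))
  | inr x, inr y => inr (mkpos (lexx gone))
  end.

Lemma K_ldiv_subproof (G : lGroup) (l : lgAut G)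
    (x : neg_lattice G) (z : pos_lattice G) :
  gone <= (l (sval x))^-1 * sval z.
Proof. by apply: gmul_ge1; [apply/ginv_le1/aut_le1; exact: svalP x|exact: svalP z]. Qed.

Lemma K_rdiv_subproof (G : lGroup) (y : neg_lattice G) (z : pos_lattice G) :
  gone <= sval z * (sval y)^-1.
Proof. by apply: gmul_ge1; [exact: svalP z|apply: ginv_le1; exact: svalP y]. Qed.

(* The residuals are forced by [K_mul] and the order: [K_ldivP], [K_rdivP]. *)
Definition K_ldiv (G : lGroup) (l : lgAut G) (x z : K_lattice G) : K_lattice G :=
  match x, z with
  | inl x, inl z => inl (neg_ldiv x z)
  | inl x, inr z => inr (mkpos (K_ldiv_subproof l x z))
  | inr x, inl z => inl (neg_one G)
  | inr x, inr z => inl (mkneg (leIr ((sval x)^-1 * sval z) gone))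
  end.

Definition K_rdiv (G : lGroup) (l : lgAut G) (z y : K_lattice G) : K_lattice G :=
  match y, z with
  | inl y, inl z => inl (neg_rdiv z y)
  | inl y, inr z => inr (mkpos (K_rdiv_subproof y z))
  | inr y, inl z => inl (neg_one G)
  | inr y, inr z => inl (mkneg (leIr (aut_inv l (sval z * (sval y)^-1)) gone))
  end.

Lemma K_le (G : lGroup) (x y : K_lattice G) :
  x <= y <-> match x, y with
             | inl x, inl y => sval x <= sval y
             | inl _, inr _ => False
             | inr _, inl _ => True
             | inr x, inr y => sval x <= sval y
             end.
Proof.
case: x y => [x|x] [y|y]; rewrite -?sub_le //.
- by split=> [[]//|h]; congr inl.
- by split=> [[]//|h]; congr inr.
Qed.

Lemma joinge (T : lattice) (a b c : T) : b <= c -> join a b <= c <-> a <= c.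
Proof. by move=> bc; rewrite joinP; split=> [[]|]. Qed.

Lemma meetle (T : lattice) (a b c : T) : c <= b -> c <= meet a b <-> c <= a.
Proof. by move=> bc; rewrite meetP; split=> [[]|]. Qed.

Lemma K_ldivP (G : lGroup) (l : lgAut G) (x y z : K_lattice G) :
  y <= K_ldiv l x z <-> K_mul l x y <= z.
Proof.
case: x y z => [x|x] [y|y] [z|z]; rewrite !K_le //=.
- by rewrite meetle ?gdivl //; exact: svalP y.
- by rewrite joinge ?gdivl //; exact: svalP z.
- by split=> // _; exact: svalP y.
- by rewrite meetle ?joinge ?gdivl //; [exact: svalP z|exact: svalP y].
- by split=> // _; exact: svalP z.
Qed.

Lemma K_rdivP (G : lGroup) (l : lgAut G) (x y z : K_lattice G) :
  x <= K_rdiv l z y <-> K_mul l x y <= z.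
Proof.
case: x y z => [x|x] [y|y] [z|z]; rewrite !K_le //=.
- by rewrite meetle ?gdivr //; exact: svalP x.
- by split=> // _; exact: svalP x.
- rewrite meetle ?joinge; [|exact: svalP z|exact: svalP x].
  by rewrite (aut_le l) aut_invK gdivr.
- by rewrite joinge ?gdivr //; exact: svalP z.
- by split=> // _; exact: svalP z.
Qed.

Lemma joinJ_l (G : lGroup) (a b : G) :
  a <= gone -> join (a * join b gone) gone = join (a * b) gone.
Proof.
by move=> a1; rewrite gmulUl gmul1r -joinA (iffLR (le_join _ _) a1).
Qed.

Lemma joinJ_r (G : lGroup) (a b : G) :
  a <= gone -> join (join b gone * a) gone = join (b * a) gone.
Proof.
by move=> a1; rewrite gmulUr gmul1l -joinA (iffLR (le_join _ _) a1).
Qed.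

Lemma joinJ_1 (G : lGroup) (a : G) : a <= gone -> join a gone = gone.
Proof. by move/le_join. Qed.

Lemma K_mulA (G : lGroup) (l : lgAut G) (x y z : K_lattice G) :
  K_mul l x (K_mul l y z) = K_mul l (K_mul l x y) z.
Proof.
case: x y z => [[x hx]|[x hx]] [[y hy]|[y hy]] [[z hz]|[z hz]] //=;
  congr (_ _); apply: sig_ext => /=;
  rewrite ?aut_mul ?joinJ_l ?joinJ_r ?gmulA ?gmul1l ?gmul1r //;
  try exact: aut_le1.
all: rewrite ?joinJ_1 //; exact: aut_le1.
Qed.

Definition K_resLattice (G : lGroup) (l : lgAut G) : resLattice.
Proof.
exists (K_lattice G) (K_mul l) (K_ldiv l) (K_rdiv l) (inl (neg_one G)).
- exact: K_mulA.
- move=> [[x hx]|[x hx]] /=; congr (_ _); apply: sig_ext => /=;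
  by rewrite ?aut_one gmul1l // join_l.
- move=> [[x hx]|[x hx]] /=; congr (_ _); apply: sig_ext => /=;
  by rewrite gmul1r // join_l.
- exact: K_ldivP.
- exact: K_rdivP.
Defined.

Definition K_FLw (G : lGroup) (l : lgAut G) : FLw.
Proof.
exists (K_resLattice l) (inr (mkpos (lexx gone)));
  by move=> [[x hx]|[x hx]]; apply/K_le.
Defined.

Lemma K_pseudoMV (G : lGroup) (l : lgAut G) : pseudoMV (K_FLw l).
Proof.
case=> [[x hx]|[x hx]] [[y hy]|[y hy]]; split=> /=;
  congr (_ _); apply: sig_ext => /=.
- rewrite ginvI ginvM ginvK ginv1 gmulUl gmulVKl gmul1r joinC.
  by rewrite meetC meet_r //; exact: leUx.
- rewrite ginvI ginvM ginvK ginv1 gmulUr gmulVKr gmul1l joinC.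
  by rewrite meetC meet_r //; exact: leUx.
- by rewrite ginv1 gmul1r.
- by rewrite ginv1 gmul1l.
- by rewrite ginvM ginvK gmulVKl aut_funK.
- by rewrite ginvM ginvK gmulVKr.
- by rewrite ginvI ginvM ginvK ginv1 gmulUl gmulVKl gmul1r joinC.
- rewrite aut_meet aut_invK aut_one ginvI ginvM ginvK ginv1.
  by rewrite gmulUr gmulVKr gmul1l joinC.
Qed.

Definition K_hom (G : lGroup) (l : lgAut G) : flHom (K_FLw l) two.
Proof.
unshelve eexists; first exists (fun x : K_FLw l => if x is inl _ then true else false).
all: first [by [] | by move=> [x|x] [y|y]].
Defined.

Lemma K_perfect (G : lGroup) (l : lgAut G) : perfect (K_FLw l).
Proof. by exists (K_hom l) => -[x|x] [y|y] // _ _; apply/K_le. Qed.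

Definition K_alg (G : lGroup) (l : lgAut G) : perfectPMV :=
  PerfectPMV (@K_pseudoMV G l) (K_perfect l).

Lemma hA_K (G : lGroup) (l : lgAut G) (x : K_alg l) :
  hA (K_alg l) x = if x is inl _ then true else false.
Proof. by rewrite -(hA_unique (K_hom l : flHom (K_alg l) two)). Qed.

Record BCycle := MkBCycle {
  bc_sort :> Type;
  bc_fun : bc_sort -> bc_sort;
  bc_inv : bc_sort -> bc_sort;
  bc_funK : cancel bc_fun bc_inv;
  bc_invK : cancel bc_inv bc_fun }.

Record bcHom (B C : BCycle) := BcHom {
  bc_map :> B -> C;
  bc_comm : forall i, bc_map (bc_fun i) = bc_fun (bc_map i) }.

Lemma bcHom_ext (B C : BCycle) (f g : bcHom B C) : (forall i, f i = g i) -> f = g.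
Proof.
case: f g => [f f1] [g g1] /= /functional_extensionality e.
by move: f1; rewrite e => f1; f_equal; apply: proof_irrelevance.
Qed.

Lemma bc_comm_inv (B C : BCycle) (f : bcHom B C) (i : B) :
  f (bc_inv i) = bc_inv (f i).
Proof. by rewrite -[RHS](congr1 (fun j => bc_inv (f j)) (bc_invK i)) bc_comm bc_funK. Qed.

Definition bc_id (B : BCycle) : bcHom B B.
Proof. by exists id. Defined.

Definition bc_comp (B C D : BCycle) (g : bcHom C D) (f : bcHom B C) : bcHom B D.
Proof. by exists (fun i => g (f i)) => i; rewrite !bc_comm. Defined.

Definition pow_lattice (B : Type) (T : lattice) : lattice.
Proof.
exists (B -> T) (fun x y i => meet (x i) (y i)) (fun x y i => join (x i) (y i))
  => *; apply: functional_extensionality => i.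
- exact: meetC.
- exact: joinC.
- exact: meetA.
- exact: joinA.
- exact: meet_join.
- exact: join_meet.
Defined.

Lemma pow_le (B : Type) (T : lattice) (x y : pow_lattice B T) :
  x <= y <-> forall i, x i <= y i.
Proof.
split=> [e i|e]; last by apply: functional_extensionality => i; exact: e.
exact: (congr1 (fun z => z i) e).
Qed.

Definition lg_pow (B : Type) (L : lGroup) : lGroup.
Proof.
exists (pow_lattice B L) (fun x y i => x i * y i) (fun x i => (x i)^-1)
  (fun _ => gone).
- by move=> *; apply: functional_extensionality => i; exact: gmulA.
- by move=> *; apply: functional_extensionality => i; exact: gmul1l.
- by move=> *; apply: functional_extensionality => i; exact: gmul1r.
- by move=> *; apply: functional_extensionality => i; exact: gmulVl.
- by move=> *; apply: functional_extensionality => i; exact: gmulVr.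
- by move=> a b x y /pow_le xy; apply/pow_le => i; exact: gmul_le.
Defined.

Definition shift (B : BCycle) (L : lGroup) : lgAut (lg_pow B L).
Proof.
exists (fun x i => x (bc_fun i)) (fun x i => x (bc_inv i)) => //.
- by move=> x; apply: functional_extensionality => i; rewrite bc_invK.
- by move=> x; apply: functional_extensionality => i; rewrite bc_funK.
Defined.

Definition kite (L : lGroup) (B : BCycle) : perfectPMV := K_alg (shift B L).

Definition neg_at (L : lGroup) (B : Type) (x : neg_lattice (lg_pow B L)) (i : B) :
  neg_lattice L := mkneg (iffLR (pow_le _ _) (svalP x) i).

Definition pos_at (L : lGroup) (B : Type) (x : pos_lattice (lg_pow B L)) (i : B) :
  pos_lattice L := mkpos (iffLR (pow_le _ _) (svalP x) i).

(* The value x(i), in the disjoint union of L^- and L^+, of an element x of the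
   kite at the index i. *)
Definition kite_at (L : lGroup) (B : BCycle) (x : kite L B) (i : B) :
    neg_lattice L + pos_lattice L :=
  match x with
  | inl x => inl (neg_at x i)
  | inr x => inr (pos_at x i)
  end.

Lemma kite_F_subproof (L : lGroup) (B : BCycle) (x : B -> neg_cone L) :
  ((fun i => sval (x i)) : lg_pow B L) <= gone.
Proof. by apply/pow_le => i; exact: svalP (x i). Qed.

(* A family of elements of L^- as an element of the filter of the kite. *)
Definition kite_F (L : lGroup) (B : BCycle) (x : B -> neg_cone L) :
    F_alg (kite L B) :=
  exist _ (inl (mkneg (kite_F_subproof x))) (hA_K (l := shift B L) (inl _)).

Lemma neg_reindex_subproof (L : lGroup) (B C : Type) (f : B -> C)
    (x : neg_lattice (lg_pow C L)) :
  ((fun i => sval x (f i)) : lg_pow B L) <= gone.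
Proof. by apply/pow_le => i; exact: (iffLR (pow_le _ _) (svalP x) (f i)). Qed.

Lemma pos_reindex_subproof (L : lGroup) (B C : Type) (f : B -> C)
    (x : pos_lattice (lg_pow C L)) :
  gone <= ((fun i => sval x (f i)) : lg_pow B L).
Proof. by apply/pow_le => i; exact: (iffLR (pow_le _ _) (svalP x) (f i)). Qed.

Definition neg_reindex (L : lGroup) (B C : Type) (f : B -> C)
    (x : neg_lattice (lg_pow C L)) : neg_lattice (lg_pow B L) :=
  mkneg (neg_reindex_subproof f x).

Definition pos_reindex (L : lGroup) (B C : Type) (f : B -> C)
    (x : pos_lattice (lg_pow C L)) : pos_lattice (lg_pow B L) :=
  mkpos (pos_reindex_subproof f x).

Definition kite_map_fun (L : lGroup) (B C : BCycle) (f : bcHom B C)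
    (x : kite L C) : kite L B :=
  match x with
  | inl x => inl (neg_reindex f x)
  | inr x => inr (pos_reindex f x)
  end.

Definition kite_map (L : lGroup) (B C : BCycle) (f : bcHom B C) :
  flHom (kite L C) (kite L B).
Proof.
unshelve eexists; first exists (kite_map_fun f).
all: try (move=> [x|x] [y|y]); rewrite /=; congr (_ _);
  apply: sig_ext; apply: functional_extensionality => i //=.
all: by rewrite ?bc_comm ?bc_comm_inv.
Defined.

Definition homL (L : lGroup) (A : perfectPMV) : BCycle.
Proof.
exists (rlHom (F_alg A) (neg_cone L))
  (fun alpha => rl_comp alpha (F_tt A)) (fun alpha => rl_comp alpha (F_nn A)).
- by move=> alpha; apply: rlHom_ext => x /=; rewrite F_nnK.
- by move=> alpha; apply: rlHom_ext => x /=; rewrite F_ttK.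
Defined.

Definition homL_map (L : lGroup) (A1 A2 : perfectPMV) (f : flHom A1 A2) :
  bcHom (homL L A2) (homL L A1).
Proof.
exists (fun alpha : homL L A2 => rl_comp alpha (F_map f)).
move=> alpha; apply: rlHom_ext => x /=; congr (alpha _).
by apply: sig_ext => /=; rewrite !hom_ltil.
Defined.

Record category := Category {
  ob :> Type;
  hom : ob -> ob -> Type;
  idm : forall a, hom a a;
  comp : forall a b c, hom b c -> hom a b -> hom a c;
  comp_idl : forall a b (f : hom a b), comp (idm b) f = f;
  comp_idr : forall a b (f : hom a b), comp f (idm a) = f;
  compA : forall a b c d (h : hom c d) (g : hom b c) (f : hom a b),
    comp h (comp g f) = comp (comp h g) f }.

Record functor (C D : category) := Functor {
  fob :> C -> D;
  fmap : forall a b : C, hom a b -> hom (fob a) (fob b);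
  fmap_id : forall a, fmap (idm a) = idm (fob a);
  fmap_comp : forall a b c (g : hom b c) (f : hom a b),
    fmap (comp g f) = comp (fmap g) (fmap f) }.

Record cofunctor (C D : category) := Cofunctor {
  cob :> C -> D;
  cmap : forall a b : C, hom a b -> hom (cob b) (cob a);
  cmap_id : forall a, cmap (idm a) = idm (cob a);
  cmap_comp : forall a b c (g : hom b c) (f : hom a b),
    cmap (comp g f) = comp (cmap f) (cmap g) }.

Definition id_functor (C : category) : functor C C.
Proof. by exists id (fun _ _ f => f). Defined.

Definition cofunctor_comp (C D E : category) (G : cofunctor D E)
    (F : cofunctor C D) : functor C E.
Proof.
exists (fun a => G (F a)) (fun a b f => cmap G (cmap F f)).
- by move=> a; rewrite !cmap_id.
- by move=> a b c g f; rewrite !cmap_comp.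
Defined.

Definition natural (C D : category) (F G : functor C D)
    (eta : forall a : C, hom (F a) (G a)) : Prop :=
  forall (a b : C) (f : hom a b), comp (eta b) (fmap F f) = comp (fmap G f) (eta a).

Arguments natural {C D} F G eta.

(* The triangle identities; naturality of eta and eps is stated separately. *)
Definition contra_adjunction (C D : category) (F : cofunctor C D)
    (G : cofunctor D C) (eta : forall a : C, hom a (G (F a)))
    (eps : forall b : D, hom b (F (G b))) : Prop :=
  (forall b : D, comp (cmap G (eps b)) (eta (G b)) = idm (G b)) /\
  (forall a : C, comp (cmap F (eta a)) (eps (F a)) = idm (F a)).

Arguments contra_adjunction {C D} F G eta eps.

Definition PPMV : category.
Proof.
exists perfectPMV (fun A B => flHom A B) (fun A => fl_id A)
  (fun A B C g f => fl_comp g f) => *; exact: flHom_ext.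
Defined.

Definition BC : category.
Proof.
by exists BCycle bcHom bc_id bc_comp => *; apply: bcHom_ext.
Defined.

Definition kite_cofunctor (L : lGroup) : cofunctor BC PPMV.
Proof.
exists (kite L : BC -> PPMV) (@kite_map L).
- move=> B; apply: flHom_ext => -[x|x] /=; congr (_ _); exact: sig_ext.
- move=> B C D g f; apply: flHom_ext => -[x|x] /=; congr (_ _); exact: sig_ext.
Defined.

Definition homL_cofunctor (L : lGroup) : cofunctor PPMV BC.
Proof.
exists (homL L : PPMV -> BC) (@homL_map L).
- move=> A; apply: bcHom_ext => alpha; apply: rlHom_ext => x /=.
  by congr (alpha _); apply: sig_ext.
- move=> A B C g f; apply: bcHom_ext => alpha; apply: rlHom_ext => x /=.
  by congr (alpha _); apply: sig_ext.
Defined.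

(* Main.v *)
From mathcomp Require Import ssreflect ssrfun ssrbool.
From Stdlib Require Import FunctionalExtensionality.
Require Import Defs.
Set Implicit Arguments.
Unset Strict Implicit.
Unset Printing Implicit Defensive.
Local Open Scope alg_scope.

(** An element of a perfect pseudo MV-algebra [A] lies either in its filter,
    where a homomorphism [alpha] from the filter to [L^-] evaluates it directly,
    or in its ideal, where [ltil] moves it into the filter; evaluating there
    and inverting in [L] gives a value in [L^+]. Collecting these values over
    all [alpha] gives the unit [eta], and evaluating elements of a kite at an
    index gives the counit [eps].

    The work is in the multiplicativity of [eta]. Two observations reduce it to
    four short computations.

    - In a pseudo MV-algebra the residuals and the lattice operations are terms
      in multiplication and the two negations, and each negation is the inverse
      of the other. So a map that preserves multiplication, [ltil] and the unit
      is a homomorphism ([pmv_hom]), and the only residual of the kite that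
      enters the verification for [eta] is [ltil].
    - A product lies in the ideal as soon as one factor does, and its [ltil] is
      a residual formed inside the filter: it is [y \ x~] when [y] is in the
      filter ([ltil_mul]) and [y~ / x~~] when [x] is ([ltil_mul_tt]). A
      homomorphism [alpha] sends these residuals to quotients truncated at the
      unit of [L] from above, whose inverses are the products truncated from
      below that define the kite. Two factors in the ideal have product [fl0] on
      both sides ([J_mul0]). The twist by [x~~] in the second formula is the
      reason why the bijection on the homomorphisms, and with it the
      automorphism of their kite, is given by [x |-> x~~].

    Naturality and the triangle identities then hold by evaluation, because
    every component is given by evaluation at a point and homomorphisms commute
    with [ltil]; in the ideal of a kite, [ltil] inverts pointwise, and the second
    inversion in the definition of [eta] undoes it. *)

(** * Multiplication and negation in pseudo MV-algebras *)

Lemma ltil1 (A : FLw) : ltil rone = fl0 :> A.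
Proof. by apply: le_ext => z; rewrite /ltil ldivP rmul1l. Qed.

Lemma ltil0 (A : FLw) : ltil fl0 = rone :> A.
Proof.
apply: le_anti; first exact: fl_le1.
by apply/ldivP; rewrite rmul1r; exact: lexx.
Qed.

Section Terms.
Variables (A : FLw) (P : pseudoMV A).

Lemma ltil_mul (x y : A) : ltil (rmul x y) = ldiv y (ltil x).
Proof. by apply: le_ext => z; rewrite /ltil !ldivP rmulA. Qed.

(** Moving [x] cyclically from the front of [x y z <= 0] to the back replaces
    it by [x~~]. *)
Lemma ltil_mul_tt (x y : A) :
  ltil (rmul x y) = rdiv (ltil y) (ltil (ltil x)).
Proof.
apply: le_ext => z; rewrite rdivP /ltil !ldivP -/(ltil x) -/(ltil (ltil x)).
by rewrite -rmulA mul0_cyc // rmulA.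
Qed.

(** A residual is the [lneg] of a product because [u <= lneg w] means
    [u w <= 0]; this lemma and [ldiv_lneg] rewrite the residuation condition,
    with [z] replaced by [lneg (ltil z)], in that form. *)
Lemma rdiv_lneg (z y : A) : rdiv z y = lneg (rmul y (ltil z)).
Proof.
apply: le_ext => u; rewrite rdivP -{1}[z]ltilK //.
by rewrite /lneg !rdivP rmulA.
Qed.

Lemma ldiv_lneg (x z : A) : ldiv x z = lneg (rmul (ltil z) (ltil (ltil x))).
Proof.
apply: le_ext => u; rewrite ldivP -{1}[z]ltilK //.
by rewrite /lneg !rdivP -rmulA mul0_cyc // rmulA.
Qed.

Lemma meet_ltil (x y : A) : meet x y = lneg (join (ltil x) (ltil y)).
Proof.
apply: le_ext => z; rewrite meetP (le_ltil P z (lneg _)) lnegK // joinP.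
by rewrite -!le_ltil.
Qed.

End Terms.

(** * Homomorphisms from multiplication and negation *)

Section Hom.
Variables (A C : FLw) (PA : pseudoMV A) (PC : pseudoMV C) (f : A -> C).
Hypotheses (fM : forall x y, f (rmul x y) = rmul (f x) (f y))
  (fT : forall x, f (ltil x) = ltil (f x)) (f1 : f rone = rone).

Lemma pmv_hom_lneg x : f (lneg x) = lneg (f x).
Proof. by rewrite -[LHS]ltilK // -fT lnegK. Qed.

Lemma pmv_hom_ldiv x y : f (ldiv x y) = ldiv (f x) (f y).
Proof. by rewrite !ldiv_lneg // pmv_hom_lneg fM !fT. Qed.

Lemma pmv_hom_rdiv x y : f (rdiv x y) = rdiv (f x) (f y).
Proof. by rewrite !rdiv_lneg // pmv_hom_lneg fM !fT. Qed.

Lemma pmv_hom_join x y : f (join x y) = join (f x) (f y).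
Proof. by rewrite -(PA x y).1 -(PC _ _).1 pmv_hom_rdiv pmv_hom_ldiv. Qed.

Lemma pmv_hom_meet x y : f (meet x y) = meet (f x) (f y).
Proof. by rewrite !meet_ltil // pmv_hom_lneg pmv_hom_join !fT. Qed.

Lemma pmv_hom_zero : f fl0 = fl0.
Proof. by rewrite -!ltil1 fT f1. Qed.

Definition pmv_hom : flHom A C :=
  @FlHom A C (RlHom pmv_hom_meet pmv_hom_join fM pmv_hom_ldiv pmv_hom_rdiv f1)
    pmv_hom_zero.

End Hom.

(** * The unit *)

Lemma F_or_J (A : perfectPMV) (x : A) :
  {y : F_set A | x = sval y} + {y : J_set A | x = sval y}.
Proof.
case h : (hA A x); first by left; exists (exist _ x h).
by right; exists (exist _ x h).
Defined.

Section Unit.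
Variables (L : lGroup) (A : perfectPMV).

Definition eta_F (x : F_alg A) : neg_lattice (lg_pow (homL L A) L) :=
  mkneg (kite_F_subproof (fun alpha : homL L A => alpha x)).

Lemma eta_J_subproof (x : J_set A) :
  gone <= ((fun alpha : homL L A => sval (neg_inv (alpha (J_ltil x))))
           : lg_pow (homL L A) L).
Proof. by apply/pow_le => alpha; exact: svalP (neg_inv _). Qed.

Definition eta_J (x : J_set A) : pos_lattice (lg_pow (homL L A) L) :=
  mkpos (eta_J_subproof x).

(** The case distinction returns [x] as an element of [F_set A] or [J_set A],
    since [alpha] is defined only on elements paired with a proof of membership
    in the filter. *)
Definition eta_fun (x : A) : kite L (homL L A) :=
  match F_or_J x with
  | inl (exist y _) => inl (eta_F y)
  | inr (exist y _) => inr (eta_J y)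
  end.

Lemma eta_funF (x : F_set A) : eta_fun (sval x) = inl (eta_F x).
Proof.
rewrite /eta_fun; case: (F_or_J (sval x)) => -[y e].
  by rewrite (sig_ext e).
by have := svalP y; rewrite -e (svalP x).
Qed.

Lemma eta_funJ (x : J_set A) : eta_fun (sval x) = inr (eta_J x).
Proof.
rewrite /eta_fun; case: (F_or_J (sval x)) => -[y e].
  by have := svalP y; rewrite -e (svalP x).
by rewrite (sig_ext e).
Qed.

Lemma eta_fun_F (x : A) (h : hA A x = true) :
  eta_fun x = inl (eta_F (exist _ x h)).
Proof. exact: (eta_funF (exist _ x h)). Qed.

Lemma eta_fun_J (x : A) (h : hA A x = false) :
  eta_fun x = inr (eta_J (exist _ x h)).
Proof. exact: (eta_funJ (exist _ x h)). Qed.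

(** The element [ltil x] is in the filter, hence above the ideal element [y]. *)
Lemma J_mul0 (x y : J_set A) : rmul (sval x) (sval y) = fl0.
Proof.
apply: le_anti; last exact: fl_ge0.
apply/ldivP; apply: (hA_separating (A := A)); first exact: svalP y.
by rewrite -/(ltil _) hA_ltil (svalP x).
Qed.

(** In each case [J_ltil] of the product, or the product itself, is rewritten
    as an operation of the filter, which [alpha] preserves. *)
Lemma eta_fun_mul (x y : A) :
  eta_fun (rmul x y) = rmul (eta_fun x) (eta_fun y).
Proof.
case: (F_or_J x) (F_or_J y) => -[{}x ->] [[{}y ->]|[{}y ->]].
- have h : hA A (rmul (sval x) (sval y)) = true.
    by rewrite rl_mul (svalP x) (svalP y).
  rewrite !eta_funF (eta_fun_F h) /=; congr inl.
  apply: sig_ext; apply: functional_extensionality => alpha /=.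
  rewrite -[RHS]/(sval (rmul (alpha x) (alpha y))) -rl_mul.
  by congr (sval (alpha _)); apply: sig_ext.
- have h : hA A (rmul (sval x) (sval y)) = false.
    by rewrite rl_mul (svalP x) (svalP y).
  rewrite eta_funF eta_funJ (eta_fun_J h) /=; congr inr.
  apply: sig_ext; apply: functional_extensionality => alpha /=.
  have -> : J_ltil (exist _ _ h) = rdiv (J_ltil y) (F_tt_fun x).
    by apply: sig_ext; exact/ltil_mul_tt/ppmv_pseudoMV.
  by rewrite rl_rdiv /= ginvI ginvM ginvK ginv1.
- have h : hA A (rmul (sval x) (sval y)) = false.
    by rewrite rl_mul (svalP x) (svalP y).
  rewrite eta_funF eta_funJ (eta_fun_J h) /=; congr inr.
  apply: sig_ext; apply: functional_extensionality => alpha /=.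
  have -> : J_ltil (exist _ _ h) = ldiv (y : F_alg A) (J_ltil x).
    by apply: sig_ext; exact: ltil_mul.
  by rewrite rl_ldiv /= ginvI ginvM ginvK ginv1.
- have h : hA A (rmul (sval x) (sval y)) = false.
    by rewrite rl_mul (svalP x) (svalP y).
  rewrite !eta_funJ (eta_fun_J h) /=; congr inr.
  apply: sig_ext; apply: functional_extensionality => alpha /=.
  have -> : J_ltil (exist _ _ h) = rone.
    by apply: sig_ext; rewrite /= J_mul0 ltil0.
  by rewrite rl_one /= ginv1.
Qed.

Lemma eta_fun_ltil (x : A) : eta_fun (ltil x) = ltil (eta_fun x).
Proof.
case: (F_or_J x) => -[{}x ->].
- have h : hA A (ltil (sval x)) = false by rewrite hA_ltil (svalP x).
  rewrite eta_funF (eta_fun_J h) /=; congr inr.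
  apply: sig_ext; apply: functional_extensionality => alpha /=.
  by rewrite gmul1r; congr (sval (alpha _))^-1; apply: sig_ext.
- rewrite eta_funJ (eta_fun_F (J_ltil_subproof x)) /=; congr inl.
  apply: sig_ext; apply: functional_extensionality => alpha /=.
  by rewrite gmul1r ginvK (svalP (alpha _)).
Qed.

Lemma eta_fun1 : eta_fun rone = rone.
Proof.
rewrite (eta_fun_F (rl_one (hA A))) /=; congr inl.
apply: sig_ext; apply: functional_extensionality => alpha /=.
by have /(congr1 (fun z => sval z)) := rl_one alpha.
Qed.

Definition eta : flHom A (kite L (homL L A)) :=
  pmv_hom (@ppmv_pseudoMV A) (@K_pseudoMV _ _) eta_fun_mul eta_fun_ltil eta_fun1.

Lemma etaF (x : F_set A) : eta (sval x) = inl (eta_F x).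
Proof. exact: eta_funF. Qed.

Lemma etaJ (x : J_set A) : eta (sval x) = inr (eta_J x).
Proof. exact: eta_funJ. Qed.

End Unit.

Lemma eta_natural (L : lGroup) :
  natural (id_functor PPMV)
    (cofunctor_comp (kite_cofunctor L) (homL_cofunctor L)) (eta L).
Proof.
move=> A B f; apply: flHom_ext => x.
rewrite -[LHS]/(eta L B (f x)) -[RHS]/(kite_map_fun (homL_map L f) (eta L A x)).
case: (F_or_J x) => -[{}x ->].
- rewrite etaF -[f _]/(sval (F_map f x)) etaF /=; congr inl.
  exact: sig_ext.
- have h : hA B (f (sval x)) = false by rewrite hA_hom (svalP x).
  rewrite etaJ -[f _]/(sval (exist _ (f (sval x)) h : J_set B)) etaJ /=.
  congr inr; apply: sig_ext; apply: functional_extensionality => alpha /=.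
  by congr (sval (alpha _))^-1; apply: sig_ext; rewrite /= hom_ltil.
Qed.

(** * The counit *)

Section Counit.
Variables (L : lGroup) (B : BCycle).

(** Elements of the ideal do not occur in the filter; the value [neg_one] given
    to them is arbitrary. *)
Definition eps_fun (i : B) (x : F_alg (kite L B)) : neg_cone L :=
  match sval x : kite L B with
  | inl y => neg_at y i
  | inr _ => neg_one L
  end.

Lemma kite_FP (x : F_alg (kite L B)) :
  exists y : neg_lattice (lg_pow B L), sval x = inl y.
Proof. by case: x => -[y|y] h; [exists y | by have := h; rewrite hA_K]. Qed.

Definition eps_at (i : B) : rlHom (F_alg (kite L B)) (neg_cone L).
Proof.
exists (eps_fun i); rewrite /eps_fun.
1-5: move=> x y; case: (kite_FP x) (kite_FP y) => x' ex [y' ey].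
1-5: by rewrite /= ex ey; exact: sig_ext.
exact: sig_ext.
Defined.

Definition eps : bcHom B (homL L (kite L B)).
Proof.
exists eps_at => i; apply: rlHom_ext => x /=; rewrite /eps_fun /=.
case: (kite_FP x) => x' -> /=; apply: sig_ext => /=.
rewrite !gmul1r ginvK meetC meet_r //.
exact: (iffLR (pow_le _ _) (svalP x') (bc_fun i)).
Defined.

End Counit.

Lemma eps_natural (L : lGroup) :
  natural (id_functor BC)
    (cofunctor_comp (homL_cofunctor L) (kite_cofunctor L)) (eps L).
Proof.
move=> B C f; apply: bcHom_ext => i; apply: rlHom_ext => x /=.
rewrite /eps_fun /=; case: (kite_FP x) => x' -> /=; exact: sig_ext.
Qed.

(** * The triangle identities *)

(** For the kite, the first identity recovers [x i] by evaluating [eta x] at the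
    projection to the index [i]; in the ideal this reads
    [(x i)^-1^-1 = x i]. For [A], the second evaluates [eta] of a filter element
    at [alpha]; as [alpha] lives on the filter, no other case arises. *)
Lemma eta_eps_adjunction (L : lGroup) :
  contra_adjunction (homL_cofunctor L) (kite_cofunctor L) (eta L) (eps L).
Proof.
split=> [B|A].
- apply: flHom_ext => x.
  rewrite -[LHS]/(kite_map_fun (eps L B) (eta L (kite L B) x)).
  rewrite -[RHS]/x.
  case: x => [x|x].
  + have h := hA_K (l := shift B L) (inl x).
    rewrite -[inl x]/(sval (exist _ (inl x) h : F_set (kite L B))) etaF /=.
    by congr inl; exact: sig_ext.
  + have h := hA_K (l := shift B L) (inr x).
    rewrite -[inr x]/(sval (exist _ (inr x) h : J_set (kite L B))) etaJ /=.
    congr inr; apply: sig_ext; apply: functional_extensionality => i /=.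
    have x1 := iffLR (pow_le _ _) (svalP x) i.
    by rewrite gmul1r ginvI ginvK ginv1 join_l.
- apply: bcHom_ext => alpha; apply: rlHom_ext => x.
  rewrite -[RHS]/(alpha x) -[LHS]/(eps_fun alpha (F_map (eta L A) x)).
  by rewrite /eps_fun -[sval _]/(eta L A (sval x)) etaF; exact: sig_ext.
Qed.

Theorem theorem6 (L : lGroup) :
  exists (eta : forall A : perfectPMV, flHom A (kite L (homL L A)))
         (eps : forall B : BCycle, bcHom B (homL L (kite L B))),
    (* (1) *)
    ((forall (A : perfectPMV) (alpha : homL L A),
        (forall x : F_set A,
           kite_at (eta A (proj1_sig x)) alpha = inl (alpha x)) /\
        (forall x : J_set A,
           kite_at (eta A (proj1_sig x)) alpha = inr (neg_inv (alpha (J_ltil x))))) /\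
     natural (id_functor PPMV)
       (cofunctor_comp (kite_cofunctor L) (homL_cofunctor L)) eta) /\
    (* (2) *)
    ((forall (B : BCycle) (i : B) (x : B -> neg_cone L),
        eps B i (kite_F x) = x i) /\
     natural (id_functor BC)
       (cofunctor_comp (homL_cofunctor L) (kite_cofunctor L)) eps) /\
    (* (3) *)
    contra_adjunction (homL_cofunctor L) (kite_cofunctor L) eta eps.
Proof.
exists (eta L), (eps L); split; [split|split; [split|]].
- move=> A alpha; split=> x.
  + by rewrite etaF /=; congr inl; exact: sig_ext.
  + by rewrite etaJ /=; congr inr; exact: sig_ext.
- exact: eta_natural.
- by move=> B i x; exact: sig_ext.
- exact: eps_natural.
- exact: eta_eps_adjunction.
Qed.
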